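(* Let $0\le a\le m$ and $r>2m$ be fixed. Let $(\tilde x_i,\tilde y_i)$, $i=1,2$, be two solutions on $[0,\pi]$, with bounded derivatives, of the system $$\begin{cases}\tilde y_\theta=-\tilde\Delta^{1/2}P\,\tilde x-\left(\dfrac{\epsilon^2cs}{1+\epsilon^2c^2}+\dfrac cs\left(1+\dfrac{pq}{1+\epsilon^2+p}\right)\right)\tilde y,\\[2mm] \tilde x_\theta=\tilde\Delta^{1/2}P\,\tilde y-\dfrac{\epsilon^2cs}{1+\epsilon^2c^2}\,\tilde x-\dfrac{\tilde\alpha\tilde\beta+\tilde x\tilde y\tilde H_\theta}{2\tilde H\tilde\ell}\,\tilde y.\end{cases}$$ Then $\tilde y_i(0)=\tilde y_i(\pi)=0$ for $i=1,2$. Moreover, if $\tilde x_1(0)=\tilde x_2(0)$ (or $\tilde x_1(\pi)=\tilde x_2(\pi)$), then $\tilde x_1=\tilde x_2$ and $\tilde y_1=\tilde y_2$ on $[0,\pi]$.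
   Context: Notation (Kerr parameters $m$, $a$; $\theta\in[0,\pi]$; subscript $\theta$ denotes derivative in $\theta$): $s=\sin\theta$, $c=\cos\theta$, $\epsilon=a/r$, $p=\dfrac{2m\epsilon^2s^2}{r(1+\epsilon^2c^2)}$, $q=\dfrac{1+\epsilon^2}{1+\epsilon^2c^2}$, $P=\dfrac{1+\frac12p+q}{1+\epsilon^2+p}$, $\tilde H=s^2(1+\epsilon^2+p)$, $\tilde\Delta=1+\epsilon^2-\dfrac{2m}{r}$, $\tilde\ell=\tilde y^2+1+\epsilon^2c^2$, $\tilde\alpha=\left[(1+\epsilon^2c^2)(\tilde x^2+\tilde y^2+1+\epsilon^2c^2)\right]^{1/2}$, $\tilde\beta=2s\left[(1+\epsilon^2+p)\tilde y^2+\left(1+\epsilon^2+\dfrac{2m\epsilon^2}{r}\right)s^2-c^2p(1+q)\left(2(1+\epsilon^2)+p(1+q)\right)\right]^{1/2}$. A solution on $[0,\pi]$ with bounded derivatives means a pair of real functions continuous on $[0,\pi]$ and differentiable on $(0,\pi)$, with bounded derivatives, satisfying the system on $(0,\pi)$ (its coefficients are singular at $\theta=0,\pi$). *)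

(* Defs.v *)
(* Real analysis over the standard library's R, with Coquelicot. *)
From Stdlib Require Import Reals.
From Coquelicot Require Import Coquelicot.

Local Open Scope R_scope.

(* In all definitions m and a are the Kerr parameters, r is the fixed radius
   and t is the angle theta.  The suffix _t stands for the tilde of the usual
   notation for the rescaled quantities. *)

Definition eps (a r : R) : R := a / r.

Definition kerr_p (m a r t : R) : R :=
  2 * m * eps a r ^ 2 * sin t ^ 2 / (r * (1 + eps a r ^ 2 * cos t ^ 2)).

Definition kerr_q (a r t : R) : R :=
  (1 + eps a r ^ 2) / (1 + eps a r ^ 2 * cos t ^ 2).

Definition kerr_P (m a r t : R) : R :=
  (1 + / 2 * kerr_p m a r t + kerr_q a r t)
  / (1 + eps a r ^ 2 + kerr_p m a r t).

Definition H_t (m a r t : R) : R :=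
  sin t ^ 2 * (1 + eps a r ^ 2 + kerr_p m a r t).

Definition H_t_theta (m a r t : R) : R := Derive (H_t m a r) t.

Definition Delta_t (m a r : R) : R := 1 + eps a r ^ 2 - 2 * m / r.

Definition ell_t (a r t y : R) : R := y ^ 2 + 1 + eps a r ^ 2 * cos t ^ 2.

Definition alpha_t (a r t x y : R) : R :=
  sqrt ((1 + eps a r ^ 2 * cos t ^ 2)
        * (x ^ 2 + y ^ 2 + 1 + eps a r ^ 2 * cos t ^ 2)).

(* sqrt is 0 on negative arguments, but for 0 <= a <= m and 2 * m < r the
   radicands used here, as well as Delta_t, are nonnegative. *)
Definition beta_t (m a r t y : R) : R :=
  let p := kerr_p m a r t in
  let q := kerr_q a r t in
  2 * sin t
  * sqrt ((1 + eps a r ^ 2 + p) * y ^ 2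
          + (1 + eps a r ^ 2 + 2 * m * eps a r ^ 2 / r) * sin t ^ 2
          - cos t ^ 2 * p * (1 + q)
            * (2 * (1 + eps a r ^ 2) + p * (1 + q))).

Definition rhs_y (m a r t x y : R) : R :=
  let p := kerr_p m a r t in
  let q := kerr_q a r t in
  - (sqrt (Delta_t m a r) * kerr_P m a r t * x)
  - (eps a r ^ 2 * cos t * sin t / (1 + eps a r ^ 2 * cos t ^ 2)
     + cos t / sin t * (1 + p * q / (1 + eps a r ^ 2 + p))) * y.

Definition rhs_x (m a r t x y : R) : R :=
  sqrt (Delta_t m a r) * kerr_P m a r t * y
  - eps a r ^ 2 * cos t * sin t / (1 + eps a r ^ 2 * cos t ^ 2) * x
  - (alpha_t a r t x y * beta_t m a r t y + x * y * H_t_theta m a r t)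
    / (2 * H_t m a r t * ell_t a r t y) * y.

(* Functions on [0, PI] are encoded as functions on R whose values outside
   [0, PI] are irrelevant: continuous_on is continuity relative to [0, PI],
   hence one-sided at the end points. *)
Definition is_solution (m a r : R) (x y : R -> R) : Prop :=
  continuous_on (fun t => 0 <= t <= PI) x /\
  continuous_on (fun t => 0 <= t <= PI) y /\
  (forall t : R, 0 < t < PI ->
     is_derive y t (rhs_y m a r t (x t) (y t)) /\
     is_derive x t (rhs_x m a r t (x t) (y t))).

Definition bounded_derivatives (x y : R -> R) : Prop :=
  exists M : R, forall t : R, 0 < t < PI ->
    Rabs (Derive x t) <= M /\ Rabs (Derive y t) <= M.

(* Main.v *)
(* Write the first equation as y' = - A x - B y - w y with A, B bounded and
   w = (cos / sin) (1 + k), where k >= 0.  Bounded derivatives force w y, hence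
   y / sin, to be bounded, so y vanishes at both poles.  Because y = O(sin) and
   the radicand of beta is h y^2 + G sin^2 with h >= 1 and G >= 0, the nonlinear
   term is Lipschitz in (x, y) uniformly in t along the two solutions.  The
   squared distance E of the solutions therefore satisfies
   E' = - 2 w (y1 - y2)^2 + O(E).  As w has the sign of cos, Gronwall's
   inequality carries E = 0 from either pole to the equator, and from there to
   every point, since w is bounded on compact subintervals. *)
Require Import Defs.
From Stdlib Require Import Reals Lra.
From Coquelicot Require Import Coquelicot.

Local Open Scope R_scope.

(** * Continuity and Gronwall estimates *)

(** For [a <= b] this is the projection of the line onto [[a, b]]. Composing with it turns
    continuity relative to [[a, b]] into continuity on the line, as the Gronwall estimates
    require. *)
Definition clamp (a b t : R) : R := Rmax a (Rmin b t).

Lemma clamp_id (a b t : R) : a <= t <= b -> clamp a b t = t.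
Proof.
  intros ht; unfold clamp; rewrite Rmin_right by lra; apply Rmax_right; lra.
Qed.

Lemma clamp_mem (a b t : R) : a <= b -> a <= clamp a b t <= b.
Proof.
  intros hab; unfold clamp, Rmax, Rmin.
  repeat destruct Rle_dec; lra.
Qed.

Lemma clamp_contract (a b s t : R) :
  a <= b -> Rabs (clamp a b s - clamp a b t) <= Rabs (s - t).
Proof.
  intros hab; unfold clamp, Rmax, Rmin.
  repeat destruct Rle_dec; unfold Rabs; repeat destruct Rcase_abs; lra.
Qed.

Lemma continuous_on_clamp (f : R -> R) (a b : R) :
  a <= b -> continuous_on (fun t => a <= t <= b) f ->
  continuity (fun t => f (clamp a b t)).
Proof.
  intros hab hf t.
  apply continuity_pt_filterlim.
  intros V hV.
  destruct (hf (clamp a b t) (clamp_mem a b t hab) V hV) as [d hd].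
  exists d; intros s hs.
  apply hd; [ | apply clamp_mem, hab].
  change (Rabs (clamp a b s - clamp a b t) < d).
  apply Rle_lt_trans with (2 := hs).
  apply clamp_contract, hab.
Qed.

Lemma is_derive_clamp (f : R -> R) (a b t l : R) :
  a < t < b -> is_derive f t l -> is_derive (fun s => f (clamp a b s)) t l.
Proof.
  intros ht; apply is_derive_ext_loc.
  assert (hd : 0 < Rmin (t - a) (b - t)) by (apply Rmin_pos; lra).
  exists (mkposreal _ hd); intros s hs.
  change (Rabs (s - t) < Rmin (t - a) (b - t)) in hs.
  pose proof (Rmin_l (t - a) (b - t)); pose proof (Rmin_r (t - a) (b - t)).
  apply Rabs_lt_between in hs.
  rewrite clamp_id; [reflexivity | lra].
Qed.

Lemma nonpos_closure (f : R -> R) (a b : R) :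
  a < b -> continuity f -> (forall t, a < t < b -> f t <= 0) ->
  forall t, a <= t <= b -> f t <= 0.
Proof.
  intros hab hf hneg t ht.
  destruct (Rle_or_lt (f t) 0) as [h | h]; [exact h | exfalso].
  destruct (proj1 (continuity_pt_locally f t) (hf t) (mkposreal _ h)) as [d hd].
  simpl in hd.
  assert (hs : exists s, a < s < b /\ Rabs (s - t) < d).
  (* An interior point near [t] is found by moving towards the midpoint: [d / 2] keeps the distance
     below [d], and [(b - a) / 4] keeps the point inside the interval. *)
  { pose proof (cond_pos d) as hdp.
    destruct (Rle_or_lt t ((a + b) / 2)) as [hm | hm].
    - exists (t + Rmin (d / 2) ((b - a) / 4)).
      pose proof (Rmin_l (d / 2) ((b - a) / 4)).
      pose proof (Rmin_r (d / 2) ((b - a) / 4)).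
      assert (0 < Rmin (d / 2) ((b - a) / 4)) by (apply Rmin_pos; lra).
      split; [lra | apply Rabs_def1; lra].
    - exists (t - Rmin (d / 2) ((b - a) / 4)).
      pose proof (Rmin_l (d / 2) ((b - a) / 4)).
      pose proof (Rmin_r (d / 2) ((b - a) / 4)).
      assert (0 < Rmin (d / 2) ((b - a) / 4)) by (apply Rmin_pos; lra).
      split; [lra | apply Rabs_def1; lra]. }
  destruct hs as [s [hs1 hs2]].
  specialize (hd s hs2); specialize (hneg s hs1).
  apply Rabs_lt_between in hd; lra.
Qed.

(** The product [f t * exp (- K * t)] has derivative [(df t - K * f t) * exp (- K * t) <= 0], so its
    sign at [a] persists at [b]. *)
Lemma gronwall_forward (f df : R -> R) (a b K : R) :
  a <= b -> continuity f ->
  (forall t, a < t < b -> is_derive f t (df t) /\ df t <= K * f t) ->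
  f a <= 0 -> f b <= 0.
Proof.
  intros hab hf hdf ha.
  (* [MVT_gen] places the mean value point in the closed interval; truncating
     the derivative at 0 makes its sign known at the end points too. *)
  destruct (MVT_gen (fun t => f t * exp (- K * t)) a b
    (fun t => Rmin 0 (df t - K * f t) * exp (- K * t))) as [c [hc heq]].
  - rewrite Rmin_left, Rmax_right by exact hab.
    intros t ht; destruct (hdf t ht) as [hd hle].
    rewrite Rmin_right by lra.
    auto_derive; [exists (df t); exact hd | ].
    rewrite (is_derive_unique (fun x : R => f x) t (df t) hd); ring.
  - intros t _; apply continuity_pt_mult; [apply hf | ].
    apply derivable_continuous_pt; reg.
  - pose proof (exp_pos (- K * a)); pose proof (exp_pos (- K * b)).
    pose proof (exp_pos (- K * c)).
    pose proof (Rmin_l 0 (df c - K * f c)).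
    assert (0 <= - Rmin 0 (df c - K * f c) * exp (- K * c) * (b - a))
      by (repeat apply Rmult_le_pos; lra).
    assert (0 <= - f a * exp (- K * a)) by (apply Rmult_le_pos; lra).
    apply Rnot_lt_le; intros hb.
    assert (0 < f b * exp (- K * b)) by (apply Rmult_lt_0_compat; lra).
    lra.
Qed.

(** The reflection [t -> - t] reduces this to the forward estimate. *)
Lemma gronwall_backward (f df : R -> R) (a b K : R) :
  a <= b -> continuity f ->
  (forall t, a < t < b -> is_derive f t (df t) /\ - (K * f t) <= df t) ->
  f b <= 0 -> f a <= 0.
Proof.
  intros hab hf hdf hb.
  replace a with (- - a) by ring.
  apply (gronwall_forward (fun t => f (- t)) (fun t => - df (- t)) (- b) (- a) K).
  - lra.
  - intros t; apply (continuity_pt_comp Ropp f); [ | apply hf].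
    apply derivable_continuous_pt; reg.
  - intros t ht; destruct (hdf (- t)) as [hd hle]; [lra | ].
    split; [ | lra].
    auto_derive; [exists (df (- t)); exact hd | ].
    rewrite (is_derive_unique (fun x : R => f x) (- t) (df (- t)) hd); ring.
  - rewrite Ropp_involutive; exact hb.
Qed.

(** Sine is monotone between [t] and [PI / 2], so [sin t] is its least value there. *)
Lemma sin_pos_on_compact (t : R) :
  0 < t < PI ->
  exists d, 0 < d /\
    forall s, Rmin t (PI / 2) <= s <= Rmax t (PI / 2) -> d <= sin s.
Proof.
  intros ht; exists (sin t); split; [apply sin_gt_0; lra | ].
  intros s hs.
  destruct (Rle_or_lt t (PI / 2)) as [h | h].
  - rewrite Rmin_left, Rmax_right in hs by lra.
    apply sin_incr_1; lra.
  - rewrite Rmin_right, Rmax_left in hs by lra.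
    apply sin_decr_1; lra.
Qed.

(* Multiplying the [Y] equation by [2 * Y] turns the singular term into
   [- 2 * w * Y ^ 2], which has a favourable sign when integrating from
   either pole to the equator; between the equator and a later point [w] is
   bounded. *)
Lemma singular_linear_uniqueness (X Y dX g w : R -> R) (K W : R) :
  continuity X -> continuity Y ->
  (forall t, 0 < t < PI -> is_derive X t (dX t)) ->
  (forall t, 0 < t < PI -> is_derive Y t (g t - w t * Y t)) ->
  (forall t, 0 < t < PI -> Rabs (dX t) <= K * (Rabs (X t) + Rabs (Y t))) ->
  (forall t, 0 < t < PI -> Rabs (g t) <= K * (Rabs (X t) + Rabs (Y t))) ->
  (forall t, 0 < t < PI -> 0 <= w t * cos t) ->
  (forall t, 0 < t < PI -> Rabs (w t) * sin t <= W) ->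
  (X 0 = 0 /\ Y 0 = 0) \/ (X PI = 0 /\ Y PI = 0) ->
  forall t, 0 <= t <= PI -> X t = 0 /\ Y t = 0.
Proof.
  intros cX cY hX hY hdX hg hwc hws hini.
  pose proof PI_RGT_0 as hpi.
  set (E := fun t => X t ^ 2 + Y t ^ 2).
  set (dE := fun t => 2 * X t * dX t + 2 * Y t * (g t - w t * Y t)).
  assert (cE : continuity E).
  { intros t; unfold E; simpl.
    apply continuity_pt_plus; repeat apply continuity_pt_mult;
      try apply cX; try apply cY; apply continuity_pt_const; intros ? ?; reflexivity. }
  assert (hE : forall t, 0 < t < PI -> is_derive E t (dE t)).
  { intros t ht; unfold E, dE.
    pose proof (hX t ht) as h1; pose proof (hY t ht) as h2.
    auto_derive.
    - repeat split; [exists (dX t); exact h1 | eexists; exact h2].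
    - rewrite (is_derive_unique (fun x : R => X x) t _ h1).
      rewrite (is_derive_unique (fun x : R => Y x) t _ h2); ring. }
  (* Without its singular term, [dE] is at most [2 * |K| * (|X| + |Y|)^2] in absolute value, and
     [(|X| + |Y|)^2 <= 2 * E]. *)
  assert (hK : forall t, 0 < t < PI ->
    Rabs (dE t + 2 * (w t * Y t ^ 2)) <= 4 * Rabs K * E t).
  { intros t ht.
    pose proof (hdX t ht) as h1; pose proof (hg t ht) as h2.
    pose proof (Rle_abs K) as hk; pose proof (Rabs_pos K) as hk0.
    pose proof (Rabs_pos (X t)) as hx0; pose proof (Rabs_pos (Y t)) as hy0.
    replace (dE t + 2 * (w t * Y t ^ 2))
      with (2 * (X t * dX t) + 2 * (Y t * g t)) by (unfold dE; ring).
    replace (E t) with (Rabs (X t) ^ 2 + Rabs (Y t) ^ 2)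
      by (unfold E; rewrite !pow2_abs; reflexivity).
    eapply Rle_trans; [apply Rabs_triang | ].
    rewrite !Rabs_mult, (Rabs_pos_eq 2) by lra.
    set (x := Rabs (X t)) in *; set (y := Rabs (Y t)) in *.
    set (k := Rabs K) in *.
    assert (K * (x + y) <= k * (x + y)) by (apply Rmult_le_compat_r; lra).
    assert (x * Rabs (dX t) <= x * (k * (x + y)))
      by (apply Rmult_le_compat_l; lra).
    assert (y * Rabs (g t) <= y * (k * (x + y)))
      by (apply Rmult_le_compat_l; lra).
    assert (0 <= k * (x - y) ^ 2)
      by (apply Rmult_le_pos; [exact hk0 | apply pow2_ge_0]).
    lra. }
  assert (E0 : forall t, 0 <= E t)
    by (intros t; unfold E; pose proof (pow2_ge_0 (X t));
        pose proof (pow2_ge_0 (Y t)); lra).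
  assert (heq : E (PI / 2) <= 0).
  { destruct hini as [[hx hy] | [hx hy]].
    - apply (gronwall_forward E dE 0 (PI / 2) (4 * Rabs K)); [lra | exact cE | | ].
      + intros t ht; split; [apply hE; lra | ].
        assert (ht' : 0 < t < PI) by lra.
        pose proof (hK t ht') as h; apply Rabs_le_between in h.
        pose proof (hwc t ht').
        assert (0 < cos t) by (apply cos_gt_0; lra).
        assert (0 <= w t) by nra.
        assert (0 <= w t * Y t ^ 2)
          by (apply Rmult_le_pos; [assumption | apply pow2_ge_0]).
        lra.
      + unfold E; rewrite hx, hy; lra.
    - apply (gronwall_backward E dE (PI / 2) PI (4 * Rabs K)); [lra | exact cE | | ].
      + intros t ht; split; [apply hE; lra | ].
        assert (ht' : 0 < t < PI) by lra.
        pose proof (hK t ht') as h; apply Rabs_le_between in h.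
        pose proof (hwc t ht').
        assert (cos t < 0) by (apply cos_lt_0; lra).
        assert (0 <= - w t) by nra.
        assert (0 <= - w t * Y t ^ 2)
          by (apply Rmult_le_pos; [assumption | apply pow2_ge_0]).
        lra.
      + unfold E; rewrite hx, hy; lra. }
  (* Between [t] and the equator [sin >= d], hence [|w| <= W / d]. The resulting bound on [|dE|] is
     two-sided, so Gronwall applies in either direction from [PI / 2]. *)
  assert (hin : forall t, 0 < t < PI -> E t <= 0).
  { intros t ht.
    destruct (sin_pos_on_compact t ht) as [d [hd hsin]].
    assert (hgr : forall s, 0 < s < PI ->
      Rmin t (PI / 2) <= s <= Rmax t (PI / 2) ->
      Rabs (dE s) <= (4 * Rabs K + 2 * (W / d)) * E s).
    { intros s hs hs'.
      pose proof (hK s hs) as h; pose proof (hws s hs) as h'.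
      pose proof (Rabs_pos (w s)) as hw0.
      assert (hw : Rabs (w s) <= W / d).
      { apply Rle_div_r; [exact hd | ].
        pose proof (Rmult_le_compat_l _ _ _ hw0 (hsin s hs')); lra. }
      assert (hwY : Rabs (w s * Y s ^ 2) <= W / d * E s).
      { rewrite Rabs_mult, (Rabs_pos_eq (Y s ^ 2)) by apply pow2_ge_0.
        apply Rmult_le_compat; [exact hw0 | apply pow2_ge_0 | exact hw | ].
        unfold E; pose proof (pow2_ge_0 (X s)); lra. }
      apply Rabs_le_between in h; apply Rabs_le_between in hwY.
      apply Rabs_le_between; lra. }
    destruct (Rle_or_lt t (PI / 2)) as [h | h].
    - rewrite Rmin_left, Rmax_right in hgr by lra.
      apply (gronwall_backward E dE t (PI / 2) (4 * Rabs K + 2 * (W / d)));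
        [lra | exact cE | | exact heq].
      intros s hs; split; [apply hE; lra | ].
      assert (hs' : Rabs (dE s) <= (4 * Rabs K + 2 * (W / d)) * E s)
        by (apply hgr; lra).
      apply Rabs_le_between in hs'; lra.
    - rewrite Rmin_right, Rmax_left in hgr by lra.
      apply (gronwall_forward E dE (PI / 2) t (4 * Rabs K + 2 * (W / d)));
        [lra | exact cE | | exact heq].
      intros s hs; split; [apply hE; lra | ].
      assert (hs' : Rabs (dE s) <= (4 * Rabs K + 2 * (W / d)) * E s)
        by (apply hgr; lra).
      apply Rabs_le_between in hs'; lra. }
  intros t ht.
  (* Continuity carries the estimate to both poles, in particular to the one where nothing was
     prescribed. *)
  pose proof (nonpos_closure E 0 PI hpi cE hin t ht) as h.
  unfold E in h.
  pose proof (pow2_ge_0 (X t)); pose proof (pow2_ge_0 (Y t)).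
  split; apply Rsqr_eq_0; rewrite Rsqr_pow2; lra.
Qed.

(** * Bounded functions and Lipschitz pairs on (0, PI) *)

(** The poles are left out because the functions of interest contain quotients by [sin] and the
    system holds on the open interval only. *)
Definition bounded (f : R -> R) : Prop :=
  exists M, forall t, 0 < t < PI -> Rabs (f t) <= M.

Lemma bounded_le (f g : R -> R) :
  bounded g -> (forall t, 0 < t < PI -> Rabs (f t) <= Rabs (g t)) -> bounded f.
Proof.
  intros [M hM] h; exists M; intros t ht.
  exact (Rle_trans _ _ _ (h t ht) (hM t ht)).
Qed.

Lemma bounded_ext (f g : R -> R) :
  bounded g -> (forall t, 0 < t < PI -> f t = g t) -> bounded f.
Proof.
  intros hg h; apply (bounded_le f g hg); intros t ht.
  rewrite h by exact ht; apply Rle_refl.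
Qed.

Lemma bounded_const (c : R) : bounded (fun _ => c).
Proof. exists (Rabs c); intros t _; apply Rle_refl. Qed.

Lemma bounded_sin : bounded sin.
Proof.
  exists 1; intros t _; apply Rabs_le; apply SIN_bound.
Qed.

Lemma bounded_cos : bounded cos.
Proof.
  exists 1; intros t _; apply Rabs_le; apply COS_bound.
Qed.

Lemma bounded_plus (f g : R -> R) :
  bounded f -> bounded g -> bounded (fun t => f t + g t).
Proof.
  intros [M hM] [N hN]; exists (M + N); intros t ht.
  pose proof (hM t ht); pose proof (hN t ht).
  pose proof (Rabs_triang (f t) (g t)); lra.
Qed.

Lemma bounded_opp (f : R -> R) : bounded f -> bounded (fun t => - f t).
Proof.
  intros [M hM]; exists M; intros t ht; rewrite Rabs_Ropp; apply hM, ht.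
Qed.

Lemma bounded_minus (f g : R -> R) :
  bounded f -> bounded g -> bounded (fun t => f t - g t).
Proof.
  intros hf hg; apply bounded_plus; [exact hf | apply bounded_opp, hg].
Qed.

Lemma bounded_mult (f g : R -> R) :
  bounded f -> bounded g -> bounded (fun t => f t * g t).
Proof.
  intros [M hM] [N hN]; exists (M * N); intros t ht; rewrite Rabs_mult.
  apply Rmult_le_compat; try apply Rabs_pos; [apply hM | apply hN]; exact ht.
Qed.

Lemma bounded_pow (f : R -> R) (n : nat) :
  bounded f -> bounded (fun t => f t ^ n).
Proof.
  intros hf; induction n as [ | n IH].
  - exact (bounded_const 1).
  - exact (bounded_mult _ _ hf IH).
Qed.

(** The lower bound 1 is the one available for the denominators [kerr_lat], [kerr_h] and [ell_t]. *)
Lemma bounded_inv (f : R -> R) :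
  (forall t, 0 < t < PI -> 1 <= f t) -> bounded (fun t => / f t).
Proof.
  intros hf; exists 1; intros t ht; pose proof (hf t ht).
  rewrite Rabs_pos_eq by (apply Rlt_le, Rinv_0_lt_compat; lra).
  rewrite <- Rinv_1; apply Rinv_le_contravar; lra.
Qed.

Lemma bounded_div (f g : R -> R) :
  bounded f -> (forall t, 0 < t < PI -> 1 <= g t) ->
  bounded (fun t => f t / g t).
Proof.
  intros hf hg; apply bounded_mult; [exact hf | apply bounded_inv, hg].
Qed.

Lemma bounded_sqrt (f : R -> R) : bounded f -> bounded (fun t => sqrt (f t)).
Proof.
  intros [M hM]; exists (sqrt M); intros t ht.
  rewrite Rabs_pos_eq by apply sqrt_pos.
  apply sqrt_le_1_alt; pose proof (Rle_abs (f t)); pose proof (hM t ht); lra.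
Qed.

(** * Calculus of Lipschitz pairs *)

(* [f] and [g] stand for one expression evaluated along two solutions at
   distance [d]. *)
Definition lipschitz_pair (d f g : R -> R) : Prop :=
  bounded f /\ bounded g /\
  exists L, forall t, 0 < t < PI -> Rabs (f t - g t) <= L * d t.

Lemma lipschitz_pair_ext (d f g f' g' : R -> R) :
  lipschitz_pair d f' g' ->
  (forall t, 0 < t < PI -> f t = f' t /\ g t = g' t) -> lipschitz_pair d f g.
Proof.
  intros [hf [hg [L hL]]] h; split; [ | split].
  - apply (bounded_ext _ _ hf); intros t ht; apply h, ht.
  - apply (bounded_ext _ _ hg); intros t ht; apply h, ht.
  - exists L; intros t ht; destruct (h t ht) as [-> ->]; apply hL, ht.
Qed.

Lemma lipschitz_pair_refl (d f : R -> R) : bounded f -> lipschitz_pair d f f.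
Proof.
  intros hf; repeat split; try exact hf; exists 0; intros t _.
  rewrite Rminus_diag, Rabs_R0; lra.
Qed.

Lemma lipschitz_pair_plus (d f g f' g' : R -> R) :
  lipschitz_pair d f g -> lipschitz_pair d f' g' ->
  lipschitz_pair d (fun t => f t + f' t) (fun t => g t + g' t).
Proof.
  intros [hf [hg [L hL]]] [hf' [hg' [L' hL']]].
  split; [ | split]; try (apply bounded_plus; assumption).
  exists (L + L'); intros t ht; pose proof (hL t ht); pose proof (hL' t ht).
  replace (f t + f' t - (g t + g' t)) with ((f t - g t) + (f' t - g' t)) by ring.
  pose proof (Rabs_triang (f t - g t) (f' t - g' t)); lra.
Qed.

Lemma lipschitz_pair_opp (d f g : R -> R) :
  lipschitz_pair d f g -> lipschitz_pair d (fun t => - f t) (fun t => - g t).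
Proof.
  intros [hf [hg [L hL]]]; split; [ | split]; try (apply bounded_opp; assumption).
  exists L; intros t ht.
  replace (- f t - - g t) with (- (f t - g t)) by ring.
  rewrite Rabs_Ropp; apply hL, ht.
Qed.

Lemma lipschitz_pair_minus (d f g f' g' : R -> R) :
  lipschitz_pair d f g -> lipschitz_pair d f' g' ->
  lipschitz_pair d (fun t => f t - f' t) (fun t => g t - g' t).
Proof.
  intros h h'; apply lipschitz_pair_plus; [exact h | ].
  apply lipschitz_pair_opp, h'.
Qed.

(* A Lipschitz bound for [b * f'] suffices when [g / b] is bounded: applied
   with [b = sin], this absorbs a factor [1 / sin] in [f'] and [g']. *)
Lemma lipschitz_pair_mult_weighted (d b f g f' g' : R -> R) :
  (forall t, 0 < t < PI -> b t <> 0) -> bounded (fun t => g t / b t) ->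
  bounded f' -> bounded g' -> lipschitz_pair d f g ->
  lipschitz_pair d (fun t => b t * f' t) (fun t => b t * g' t) ->
  lipschitz_pair d (fun t => f t * f' t) (fun t => g t * g' t).
Proof.
  intros hb [N hN] hf' hg' [hf [hg [L hL]]] [_ [_ [L' hL']]].
  split; [ | split]; try (apply bounded_mult; assumption).
  destruct hf' as [M hM].
  exists (M * L + N * L'); intros t ht.
  pose proof (hb t ht) as hbt.
  (* The difference is split so that [f' - g'] occurs only with the weight [b], and [g] only through
     [g / b]. *)
  replace (f t * f' t - g t * g' t)
    with (f' t * (f t - g t) + g t / b t * (b t * f' t - b t * g' t))
    by (field; exact hbt).
  eapply Rle_trans; [apply Rabs_triang | ].
  rewrite !(Rabs_mult (f' t)), !(Rabs_mult (g t / b t)).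
  pose proof (Rmult_le_compat _ _ _ _ (Rabs_pos _) (Rabs_pos _)
    (hM t ht) (hL t ht)).
  pose proof (Rmult_le_compat _ _ _ _ (Rabs_pos _) (Rabs_pos _)
    (hN t ht) (hL' t ht)).
  lra.
Qed.

Lemma lipschitz_pair_mult (d f g f' g' : R -> R) :
  lipschitz_pair d f g -> lipschitz_pair d f' g' ->
  lipschitz_pair d (fun t => f t * f' t) (fun t => g t * g' t).
Proof.
  intros h h'.
  apply (lipschitz_pair_mult_weighted d (fun _ => 1)); try apply h; try apply h'.
  - intros _ _; lra.
  - apply bounded_div; [apply h | intros _ _; lra].
  - apply (lipschitz_pair_ext _ _ _ _ _ h'); intros t _; lra.
Qed.

(** From [1 / f - 1 / g = - (f - g) / (f * g)] and [f * g >= 1], the Lipschitz constant is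
    preserved. *)
Lemma lipschitz_pair_inv (d f g : R -> R) :
  (forall t, 0 < t < PI -> 1 <= f t) -> (forall t, 0 < t < PI -> 1 <= g t) ->
  lipschitz_pair d f g -> lipschitz_pair d (fun t => / f t) (fun t => / g t).
Proof.
  intros h1 h2 [_ [_ [L hL]]].
  split; [ | split]; try (apply bounded_inv; assumption).
  exists L; intros t ht.
  pose proof (h1 t ht); pose proof (h2 t ht).
  apply Rle_trans with (2 := hL t ht).
  replace (/ f t - / g t) with (- (f t - g t) / (f t * g t)) by (field; lra).
  unfold Rdiv; rewrite Rabs_mult, Rabs_Ropp, Rabs_inv.
  rewrite <- (Rmult_1_r (Rabs (f t - g t))) at 2.
  apply Rmult_le_compat_l; [apply Rabs_pos | ].
  rewrite <- Rinv_1; apply Rinv_le_contravar; [lra | ].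
  rewrite Rabs_pos_eq; nra.
Qed.

(** The difference [f - g] is the difference of the roots times their sum, and that sum is at least
    1. *)
Lemma lipschitz_pair_sqrt (d f g : R -> R) :
  (forall t, 0 < t < PI -> 1 <= f t) -> (forall t, 0 < t < PI -> 1 <= g t) ->
  lipschitz_pair d f g ->
  lipschitz_pair d (fun t => sqrt (f t)) (fun t => sqrt (g t)).
Proof.
  intros h1 h2 [hf [hg [L hL]]].
  split; [ | split]; try (apply bounded_sqrt; assumption).
  exists L; intros t ht.
  pose proof (h1 t ht); pose proof (h2 t ht).
  apply Rle_trans with (2 := hL t ht).
  rewrite <- (sqrt_sqrt (f t)) at 2 by lra.
  rewrite <- (sqrt_sqrt (g t)) at 2 by lra.
  assert (1 <= sqrt (f t)) by (rewrite <- sqrt_1; apply sqrt_le_1_alt; lra).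
  assert (1 <= sqrt (g t)) by (rewrite <- sqrt_1; apply sqrt_le_1_alt; lra).
  replace (sqrt (f t) * sqrt (f t) - sqrt (g t) * sqrt (g t))
    with ((sqrt (f t) - sqrt (g t)) * (sqrt (f t) + sqrt (g t))) by ring.
  rewrite Rabs_mult, (Rabs_pos_eq (_ + _)) by lra.
  pose proof (Rabs_pos (sqrt (f t) - sqrt (g t))); nra.
Qed.

(** With [A], [B] the two roots, [(A - B) * (A + B) = h * (u - v) * (u + v)] and
    [A + B >= |u| + |v|]. The constant is independent of [g], which matters because [g] will be
    [G * sin ^ 2] and degenerates at the poles. *)
Lemma sqrt_quadratic_lipschitz (h g u v : R) :
  1 <= h -> 0 <= g ->
  Rabs (sqrt (h * u ^ 2 + g) - sqrt (h * v ^ 2 + g)) <= h * Rabs (u - v).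
Proof.
  intros hh hg.
  assert (hpos : forall z, z ^ 2 <= h * z ^ 2 + g)
    by (intros z; pose proof (pow2_ge_0 z); nra).
  assert (habs : forall z, Rabs z <= sqrt (h * z ^ 2 + g)).
  { intros z; rewrite <- sqrt_Rsqr_abs, Rsqr_pow2.
    apply sqrt_le_1_alt, hpos. }
  pose proof (habs u) as hu; pose proof (habs v) as hv.
  assert (su : sqrt (h * u ^ 2 + g) * sqrt (h * u ^ 2 + g) = h * u ^ 2 + g)
    by (apply sqrt_sqrt; pose proof (hpos u); pose proof (pow2_ge_0 u); lra).
  assert (sv : sqrt (h * v ^ 2 + g) * sqrt (h * v ^ 2 + g) = h * v ^ 2 + g)
    by (apply sqrt_sqrt; pose proof (hpos v); pose proof (pow2_ge_0 v); lra).
  set (A := sqrt (h * u ^ 2 + g)) in *; set (B := sqrt (h * v ^ 2 + g)) in *.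
  (* For [u <> v] one of the two is nonzero, so [A + B > 0] can be cancelled. *)
  destruct (Req_dec u v) as [-> | huv].
  { unfold A, B; rewrite !Rminus_diag, Rabs_R0; lra. }
  pose proof (Rabs_pos u); pose proof (Rabs_pos v).
  assert (hs : 0 < A + B).
  { destruct (Req_dec u 0) as [-> | hu0].
    - assert (0 < Rabs v) by (apply Rabs_pos_lt; intros ->; apply huv; reflexivity).
      lra.
    - assert (0 < Rabs u) by (apply Rabs_pos_lt, hu0); lra. }
  apply Rmult_le_reg_r with (1 := hs).
  rewrite <- (Rabs_pos_eq (A + B)) at 1 by lra.
  rewrite <- Rabs_mult.
  replace ((A - B) * (A + B)) with (h * ((u - v) * (u + v))) by nra.
  rewrite !Rabs_mult, (Rabs_pos_eq h) by lra.
  rewrite Rmult_assoc; apply Rmult_le_compat_l; [lra | ].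
  apply Rmult_le_compat_l; [apply Rabs_pos | ].
  pose proof (Rabs_triang u v); lra.
Qed.

(** * The coefficients of the system *)

(** The Kerr function [r^2 + a^2 cos^2] divided by [r^2]. *)
Definition kerr_lat (a r t : R) : R := 1 + eps a r ^ 2 * cos t ^ 2.

(** The cofactor of [sin t ^ 2] in [H_t]. *)
Definition kerr_h (m a r t : R) : R := 1 + eps a r ^ 2 + kerr_p m a r t.

Definition kerr_k (m a r t : R) : R :=
  kerr_p m a r t * kerr_q a r t / kerr_h m a r t.

Definition kerr_w (m a r t : R) : R := cos t / sin t * (1 + kerr_k m a r t).

Definition kerr_B (a r t : R) : R :=
  eps a r ^ 2 * cos t * sin t / kerr_lat a r t.

(* The quotient of the derivative of [H_t] by [sin]. *)
Definition kerr_eta (m a r t : R) : R :=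
  2 * cos t * kerr_h m a r t
  + 4 * m / r * eps a r ^ 2 * (1 + eps a r ^ 2) * cos t * sin t ^ 2
    * (/ kerr_lat a r t) ^ 2.

(** Written exactly as the expression under the root in [beta_t], so that [fold] recognises it. *)
Definition beta_radicand (m a r t y : R) : R :=
  (1 + eps a r ^ 2 + kerr_p m a r t) * y ^ 2
  + (1 + eps a r ^ 2 + 2 * m * eps a r ^ 2 / r) * sin t ^ 2
  - cos t ^ 2 * kerr_p m a r t * (1 + kerr_q a r t)
    * (2 * (1 + eps a r ^ 2) + kerr_p m a r t * (1 + kerr_q a r t)).

(* The coefficient of [sin t ^ 2] in [beta_radicand], once the factor
   [sin t ^ 2] of [kerr_p] is pulled out. *)
Definition kerr_G (m a r t : R) : R :=
  1 + eps a r ^ 2 + 2 * m * eps a r ^ 2 / r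
  - cos t ^ 2 * (2 * m * eps a r ^ 2 / r / kerr_lat a r t)
    * (1 + kerr_q a r t)
    * (2 * (1 + eps a r ^ 2) + kerr_p m a r t * (1 + kerr_q a r t)).

(** * Numerical bounds and factorizations of the coefficients *)

Lemma kerr_lat_ge_1 (a r t : R) : 1 <= kerr_lat a r t.
Proof.
  unfold kerr_lat.
  pose proof (pow2_ge_0 (eps a r)); pose proof (pow2_ge_0 (cos t)); nra.
Qed.

Lemma kerr_p_eq (m a r t : R) : r <> 0 ->
  kerr_p m a r t = 2 * m * eps a r ^ 2 / r / kerr_lat a r t * sin t ^ 2.
Proof.
  intros hr; pose proof (kerr_lat_ge_1 a r t).
  unfold kerr_p; fold (kerr_lat a r t); field; lra.
Qed.

Lemma kerr_q_bounds (a r t : R) : 1 <= kerr_q a r t <= 1 + eps a r ^ 2.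
Proof.
  unfold kerr_q; fold (kerr_lat a r t).
  pose proof (kerr_lat_ge_1 a r t).
  pose proof (pow2_ge_0 (eps a r)); pose proof (COS_bound t).
  split.
  - apply Rle_div_r; [lra | ].
    unfold kerr_lat; assert (cos t ^ 2 <= 1) by nra; nra.
  - apply Rle_div_l; [lra | nra].
Qed.

(** Everything follows from [2 * m / r <= 1] and [a / r <= 1 / 2], the latter because
    [a <= m < r / 2]. *)
Lemma kerr_params (m a r : R) : 0 <= a -> a <= m -> 2 * m < r ->
  0 < r /\ 0 <= 2 * m * eps a r ^ 2 / r <= eps a r ^ 2 /\
  0 <= eps a r ^ 2 <= / 4.
Proof.
  intros ha ham hr.
  assert (hr0 : 0 < r) by lra.
  assert (he0 : 0 <= eps a r ^ 2) by apply pow2_ge_0.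
  assert (hmu : 0 <= 2 * m / r <= 1).
  { split; [apply Rdiv_le_0_compat; lra | apply Rle_div_l; lra]. }
  assert (he : 0 <= eps a r <= / 2).
  { unfold eps; split; [apply Rdiv_le_0_compat; lra | apply Rle_div_l; lra]. }
  split; [exact hr0 | ].
  replace (2 * m * eps a r ^ 2 / r) with (2 * m / r * eps a r ^ 2) by (field; lra).
  split; [split; nra | split; nra].
Qed.

Lemma kerr_p_bounds (m a r t : R) : 0 <= a -> a <= m -> 2 * m < r ->
  0 <= kerr_p m a r t <= 2 * m * eps a r ^ 2 / r.
Proof.
  intros ha ham hr.
  destruct (kerr_params m a r ha ham hr) as [hr0 [[hn _] _]].
  rewrite kerr_p_eq by lra.
  pose proof (kerr_lat_ge_1 a r t).
  set (n := 2 * m * eps a r ^ 2 / r) in *.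
  assert (0 <= n / kerr_lat a r t) by (apply Rdiv_le_0_compat; lra).
  assert (n / kerr_lat a r t <= n) by (apply Rle_div_l; nra).
  pose proof (SIN_bound t).
  assert (0 <= sin t ^ 2 <= 1) by (split; nra).
  split; nra.
Qed.

Lemma kerr_h_ge_1 (m a r t : R) : 0 <= a -> a <= m -> 2 * m < r ->
  1 <= kerr_h m a r t.
Proof.
  intros ha ham hr; unfold kerr_h.
  pose proof (kerr_p_bounds m a r t ha ham hr).
  pose proof (pow2_ge_0 (eps a r)); lra.
Qed.

Lemma kerr_k_nonneg (m a r t : R) : 0 <= a -> a <= m -> 2 * m < r ->
  0 <= kerr_k m a r t.
Proof.
  intros ha ham hr; unfold kerr_k.
  pose proof (kerr_p_bounds m a r t ha ham hr).
  pose proof (kerr_q_bounds a r t); pose proof (kerr_h_ge_1 m a r t ha ham hr).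
  apply Rdiv_le_0_compat; nra.
Qed.

(** In the notation of the proof, [G = 1 + e + n - n * v * T] with [T = (1 + q) * (2 * (1 + e) + p *
    (1 + q))]. Here [v * (1 + e) <= 1] amounts to [cos ^ 2 <= 1], and [n <= e <= 1 / 4] keeps the
    negative term small enough. *)
Lemma kerr_G_nonneg (m a r t : R) : 0 <= a -> a <= m -> 2 * m < r ->
  0 <= kerr_G m a r t.
Proof.
  intros ha ham hr.
  destruct (kerr_params m a r ha ham hr) as [hr0 [hn he]].
  pose proof (kerr_p_bounds m a r t ha ham hr) as hp.
  pose proof (kerr_q_bounds a r t) as hq.
  pose proof (kerr_lat_ge_1 a r t) as hD.
  unfold kerr_G.
  set (n := 2 * m * eps a r ^ 2 / r) in *.
  set (p := kerr_p m a r t) in *; set (q := kerr_q a r t) in *.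
  replace (cos t ^ 2 * (n / kerr_lat a r t))
    with (n * (cos t ^ 2 / kerr_lat a r t)) by (field; lra).
  assert (hv0 : 0 <= cos t ^ 2 / kerr_lat a r t)
    by (apply Rdiv_le_0_compat; [apply pow2_ge_0 | lra]).
  assert (hv : cos t ^ 2 / kerr_lat a r t * (1 + eps a r ^ 2) <= 1).
  { replace (cos t ^ 2 / kerr_lat a r t * (1 + eps a r ^ 2))
      with ((cos t ^ 2 * (1 + eps a r ^ 2)) / kerr_lat a r t) by (field; lra).
    apply Rle_div_l; [lra | ].
    pose proof (COS_bound t); unfold kerr_lat; nra. }
  set (v := cos t ^ 2 / kerr_lat a r t) in *.
  set (e := eps a r ^ 2) in *.
  (* The bounds [p <= 1 / 4], [1 + q <= 9 / 4] and [2 * (1 + e) <= 5 / 2] give [441 / 64], just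
     below [69 / 10]. *)
  assert (hT : (1 + q) * (2 * (1 + e) + p * (1 + q)) <= 69 / 10).
  { assert (p * (1 + q) <= / 4 * (9 / 4)) by (apply Rmult_le_compat; lra).
    assert (0 <= p * (1 + q)) by (apply Rmult_le_pos; lra).
    apply Rle_trans with (9 / 4 * (5 / 2 + / 4 * (9 / 4)));
      [apply Rmult_le_compat; lra | lra]. }
  assert (hnv : 0 <= n * v) by (apply Rmult_le_pos; lra).
  pose proof (Rmult_le_compat_l _ _ _ hnv hT) as h1.
  assert (h2 : n * v * (69 / 10) <= 1 + e + n); [ | lra].
  (* Multiplying this by [v] and using [v * (1 + e) <= 1] gives the claim. *)
  assert (h3 : 69 / 10 * n <= (1 + e + n) * (1 + e)) by nra.
  assert (h4 : 69 / 10 * n * v <= (1 + e + n) * (1 + e) * v)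
    by (apply Rmult_le_compat_r; assumption).
  assert (h5 : (1 + e + n) * (v * (1 + e)) <= (1 + e + n) * 1)
    by (apply Rmult_le_compat_l; lra).
  lra.
Qed.

Lemma beta_radicand_eq (m a r t y : R) : r <> 0 ->
  beta_radicand m a r t y
  = kerr_h m a r t * y ^ 2 + kerr_G m a r t * sin t ^ 2.
Proof.
  intros hr; unfold beta_radicand, kerr_G.
  (* Only the factor [p] next to [cos t ^ 2] is expanded; the first one belongs to [kerr_h], and the
     inner one stays inside [kerr_G]. *)
  rewrite (kerr_p_eq m a r t hr) at 2.
  fold (kerr_h m a r t); ring.
Qed.

(** The factor [sin] cancels one of the two in [H_t], leaving a single [1 / sin] in the quotient of
    [H_t_theta] by [H_t]. *)
Lemma H_t_theta_eq (m a r t : R) : r <> 0 ->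
  H_t_theta m a r t = sin t * kerr_eta m a r t.
Proof.
  intros hr; pose proof (kerr_lat_ge_1 a r t) as hD.
  apply is_derive_unique; unfold H_t, kerr_p, kerr_eta, kerr_h.
  rewrite (kerr_p_eq m a r t hr).
  unfold kerr_lat in *.
  set (e := eps a r ^ 2) in *.
  auto_derive.
  - intros h; apply Rmult_integral in h; simpl in h, hD; lra.
  - assert (hs : sin t ^ 2 = 1 - cos t ^ 2)
      by (pose proof (sin2_cos2 t); unfold Rsqr in *; lra).
    field_simplify_eq; [ | split; [simpl in *; lra | lra]].
    (* Odd powers of [sin] become [sin] times a polynomial in [cos], after which both sides agree as
       polynomials. *)
    replace (sin t ^ 5) with (sin t ^ 2 * sin t ^ 2 * sin t) by ring.
    replace (sin t ^ 3) with (sin t ^ 2 * sin t) by ring.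
    rewrite hs; ring.
Qed.

(** * Boundedness of the coefficients *)

Lemma bounded_kerr_lat (a r : R) : bounded (kerr_lat a r).
Proof.
  apply (bounded_plus (fun _ => 1)); [apply bounded_const | ].
  apply bounded_mult; [apply bounded_const | apply bounded_pow, bounded_cos].
Qed.

Lemma bounded_kerr_q (a r : R) : bounded (kerr_q a r).
Proof.
  apply bounded_div; [apply bounded_const | intros t _; apply kerr_lat_ge_1].
Qed.

Lemma bounded_kerr_B (a r : R) : bounded (kerr_B a r).
Proof.
  apply bounded_div; [ | intros t _; apply kerr_lat_ge_1].
  apply bounded_mult; [ | apply bounded_sin].
  apply bounded_mult; [apply bounded_const | apply bounded_cos].
Qed.

Lemma bounded_kerr_p (m a r : R) : r <> 0 -> bounded (kerr_p m a r).
Proof.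
  intros hr; eapply bounded_ext; [ | intros t _; exact (kerr_p_eq m a r t hr)].
  apply bounded_mult; [ | apply bounded_pow, bounded_sin].
  apply bounded_div; [apply bounded_const | intros t _; apply kerr_lat_ge_1].
Qed.

Lemma bounded_kerr_h (m a r : R) : r <> 0 -> bounded (kerr_h m a r).
Proof.
  intros hr; apply bounded_plus; [apply bounded_const | apply bounded_kerr_p, hr].
Qed.

Lemma bounded_kerr_G (m a r : R) : r <> 0 -> bounded (kerr_G m a r).
Proof.
  intros hr; pose proof (bounded_kerr_q a r) as hq.
  pose proof (bounded_kerr_p m a r hr) as hp.
  assert (h1 : bounded (fun t => 1 + kerr_q a r t))
    by (apply bounded_plus; [apply bounded_const | exact hq]).
  apply bounded_minus; [apply bounded_const | ].
  apply bounded_mult; [apply bounded_mult; [ | exact h1] | ].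
  - apply bounded_mult; [apply bounded_pow, bounded_cos | ].
    apply bounded_div; [apply bounded_const | intros t _; apply kerr_lat_ge_1].
  - apply bounded_plus; [apply bounded_const | apply bounded_mult; assumption].
Qed.

Lemma bounded_kerr_eta (m a r : R) : r <> 0 -> bounded (kerr_eta m a r).
Proof.
  intros hr; apply bounded_plus; apply bounded_mult.
  - apply bounded_mult; [apply bounded_const | apply bounded_cos].
  - apply bounded_kerr_h, hr.
  - apply bounded_mult; [ | apply bounded_pow, bounded_sin].
    apply bounded_mult; [apply bounded_const | apply bounded_cos].
  - apply bounded_pow, bounded_inv; intros t _; apply kerr_lat_ge_1.
Qed.

Lemma bounded_kerr_k (m a r : R) : 0 <= a -> a <= m -> 2 * m < r ->
  bounded (kerr_k m a r).
Proof.
  intros ha ham hr; apply bounded_div.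
  - apply bounded_mult; [apply bounded_kerr_p; lra | apply bounded_kerr_q].
  - intros t _; apply kerr_h_ge_1; assumption.
Qed.

Lemma bounded_kerr_P (m a r : R) : 0 <= a -> a <= m -> 2 * m < r ->
  bounded (kerr_P m a r).
Proof.
  intros ha ham hr; apply bounded_div.
  - apply bounded_plus; [ | apply bounded_kerr_q].
    apply bounded_plus; [apply bounded_const | ].
    apply bounded_mult; [apply bounded_const | apply bounded_kerr_p; lra].
  - intros t _; apply kerr_h_ge_1; assumption.
Qed.

(** * The right-hand sides along solutions, with their singular factors isolated *)

Lemma rhs_y_eq (m a r t x y : R) :
  rhs_y m a r t x y
  = - (sqrt (Delta_t m a r) * kerr_P m a r t * x) - kerr_B a r t * y
    - kerr_w m a r t * y.
Proof.
  unfold rhs_y, kerr_w, kerr_k, kerr_B, kerr_h, kerr_lat; cbv zeta; ring.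
Qed.

(* Since [cos ^ 2 + sin ^ 2 = 1], bounds on [cos * y / sin] and on [y] give a
   bound on [y / sin]. *)
Lemma bounded_div_sin (m a r : R) (x y : R -> R) :
  0 <= a -> a <= m -> 2 * m < r -> bounded x -> bounded y ->
  bounded (fun t => rhs_y m a r t (x t) (y t)) ->
  bounded (fun t => y t / sin t).
Proof.
  intros ha ham hr hx hy hrhs.
  assert (hwy : bounded (fun t => kerr_w m a r t * y t)).
  { apply (bounded_ext _ (fun t =>
      - (sqrt (Delta_t m a r) * kerr_P m a r t * x t) - kerr_B a r t * y t
      - rhs_y m a r t (x t) (y t))).
    - apply bounded_minus; [apply bounded_minus | exact hrhs].
      + apply bounded_opp, bounded_mult; [ | exact hx].
        apply bounded_mult; [apply bounded_const | ].
        apply bounded_kerr_P; assumption.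
      + apply bounded_mult; [apply bounded_kerr_B | exact hy].
    - intros t _; rewrite rhs_y_eq; ring. }
  assert (hcy : bounded (fun t => cos t / sin t * y t)).
  (* Since [1 + k >= 1], dropping this factor of [w] does not increase the absolute value. *)
  { apply (bounded_le _ _ hwy); intros t _; unfold kerr_w.
    rewrite !Rabs_mult.
    pose proof (kerr_k_nonneg m a r t ha ham hr).
    rewrite (Rabs_pos_eq (1 + _)) by lra.
    apply Rmult_le_compat_r; [apply Rabs_pos | ].
    pose proof (Rabs_pos (cos t / sin t)); nra. }
  apply (bounded_ext _ (fun t => cos t * (cos t / sin t * y t) + sin t * y t)).
  - apply bounded_plus; apply bounded_mult;
      auto using bounded_cos, bounded_sin.
  - intros t ht.
    assert (0 < sin t) by (apply sin_gt_0; lra).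
    pose proof (sin2_cos2 t) as h; unfold Rsqr in h.
    field_simplify_eq; [ | lra].
    replace (y t) with (y t * (sin t * sin t + cos t * cos t)) at 1
      by (rewrite h; ring).
    ring.
Qed.

(** On the open interval [beta_t] is [2 * sin t ^ 2 * beta_sigma], whose [sin t ^ 2] cancels that of
    [H_t]. *)
Definition beta_sigma (m a r t y : R) : R :=
  sqrt (beta_radicand m a r t y) / sin t.

(** After cancelling powers of [sin], the singular quotients are confined to [beta_sigma] and
    [y / sin t], each multiplied by a further factor [y]. *)
Lemma rhs_x_eq (m a r t x y : R) : 0 <= a -> a <= m -> 2 * m < r ->
  0 < t < PI ->
  rhs_x m a r t x y
  = sqrt (Delta_t m a r) * kerr_P m a r t * y - kerr_B a r t * x
    - (alpha_t a r t x y * (y * beta_sigma m a r t y)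
       + x * (y * (y / sin t)) * (kerr_eta m a r t / 2))
      * (/ kerr_h m a r t * / ell_t a r t y).
Proof.
  intros ha ham hr ht.
  assert (0 < sin t) by (apply sin_gt_0; lra).
  pose proof (kerr_h_ge_1 m a r t ha ham hr).
  assert (1 <= ell_t a r t y).
  { unfold ell_t; pose proof (kerr_lat_ge_1 a r t) as h; unfold kerr_lat in h.
    pose proof (pow2_ge_0 y); lra. }
  unfold rhs_x; rewrite H_t_theta_eq by lra.
  unfold beta_t; cbv zeta; fold (beta_radicand m a r t y).
  unfold H_t; fold (kerr_h m a r t); unfold beta_sigma, kerr_B, kerr_lat.
  unfold Rminus; f_equal; field.
  repeat split; lra.
Qed.

(** The estimate of [sqrt_quadratic_lipschitz] is applied at each [t] with [g = G * sin ^ 2]; its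
    constant [h] is bounded in [t]. *)
Lemma lipschitz_pair_beta (m a r : R) (d y1 y2 : R -> R) :
  0 <= a -> a <= m -> 2 * m < r -> lipschitz_pair d y1 y2 ->
  lipschitz_pair d (fun t => sqrt (beta_radicand m a r t (y1 t)))
    (fun t => sqrt (beta_radicand m a r t (y2 t))).
Proof.
  intros ha ham hr hy.
  assert (hb : forall y, bounded y ->
    bounded (fun t => sqrt (beta_radicand m a r t (y t)))).
  { intros y hby; apply bounded_sqrt.
    eapply bounded_ext;
      [ | intros t _; apply (beta_radicand_eq m a r t (y t)); lra].
    apply bounded_plus; apply bounded_mult.
    - apply bounded_kerr_h; lra.
    - apply bounded_pow, hby.
    - apply bounded_kerr_G; lra.
    - apply bounded_pow, bounded_sin. }
  destruct hy as [hy1 [hy2 [L hL]]].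
  split; [ | split]; [apply hb, hy1 | apply hb, hy2 | ].
  destruct (bounded_kerr_h m a r) as [M hM]; [lra | ].
  exists (M * L); intros t ht.
  rewrite !beta_radicand_eq by lra.
  pose proof (kerr_h_ge_1 m a r t ha ham hr) as hh.
  eapply Rle_trans; [apply sqrt_quadratic_lipschitz; [exact hh | ] | ].
  - apply Rmult_le_pos; [apply kerr_G_nonneg; assumption | apply pow2_ge_0].
  - rewrite Rmult_assoc; apply Rmult_le_compat; [lra | apply Rabs_pos | | ].
    + pose proof (hM t ht); pose proof (Rle_abs (kerr_h m a r t)); lra.
    + apply hL, ht.
Qed.

(** Taking [sin ^ 2] out of the root turns [beta_sigma] into the root of [h * (y / sin) ^ 2 + G]. *)
Lemma bounded_beta_sigma (m a r : R) (y : R -> R) :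
  0 <= a -> a <= m -> 2 * m < r -> bounded (fun t => y t / sin t) ->
  bounded (fun t => beta_sigma m a r t (y t)).
Proof.
  intros ha ham hr hu.
  apply (bounded_ext _ (fun t =>
    sqrt (kerr_h m a r t * (y t / sin t) ^ 2 + kerr_G m a r t))).
  - apply bounded_sqrt, bounded_plus; [ | apply bounded_kerr_G; lra].
    apply bounded_mult; [apply bounded_kerr_h; lra | apply bounded_pow, hu].
  - intros t ht; unfold beta_sigma.
    assert (0 < sin t) by (apply sin_gt_0; lra).
    rewrite beta_radicand_eq by lra.
    replace (kerr_h m a r t * y t ^ 2 + kerr_G m a r t * sin t ^ 2)
      with (sin t ^ 2
            * (kerr_h m a r t * (y t / sin t) ^ 2 + kerr_G m a r t))
      by (field; lra).
    rewrite sqrt_mult_alt, sqrt_pow2 by (try apply pow2_ge_0; lra).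
    field; lra.
Qed.

(** The products [y * beta_sigma] and [y * (y / sin)] are treated by the weighted product rule with
    weight [sin]: multiplied by [sin], their second factors become the root of [beta_radicand] and
    [y], which are Lipschitz. All other factors are Lipschitz themselves. *)
Lemma lipschitz_pair_rhs_x (m a r : R) (d x1 y1 x2 y2 : R -> R) :
  0 <= a -> a <= m -> 2 * m < r ->
  lipschitz_pair d x1 x2 -> lipschitz_pair d y1 y2 ->
  bounded (fun t => y1 t / sin t) -> bounded (fun t => y2 t / sin t) ->
  lipschitz_pair d (fun t => rhs_x m a r t (x1 t) (y1 t))
    (fun t => rhs_x m a r t (x2 t) (y2 t)).
Proof.
  intros ha ham hr hx hy hu1 hu2.
  assert (hsin : forall t, 0 < t < PI -> sin t <> 0)
    by (intros t ht; pose proof (sin_gt_0 t); lra).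
  assert (hell : forall t y, 1 <= ell_t a r t y).
  { intros t y; unfold ell_t; pose proof (kerr_lat_ge_1 a r t) as h.
    unfold kerr_lat in h; pose proof (pow2_ge_0 y); lra. }
  assert (sq : forall f g, lipschitz_pair d f g ->
    lipschitz_pair d (fun t => f t ^ 2) (fun t => g t ^ 2)).
  { intros f g h; eapply lipschitz_pair_ext;
      [exact (lipschitz_pair_mult _ _ _ _ _ h h) | intros t _; lra]. }
  assert (hlat := lipschitz_pair_refl d _ (bounded_kerr_lat a r)).
  assert (halpha : lipschitz_pair d (fun t => alpha_t a r t (x1 t) (y1 t))
                     (fun t => alpha_t a r t (x2 t) (y2 t))).
  { assert (hge : forall t x y,
      1 <= kerr_lat a r t * (x ^ 2 + y ^ 2 + kerr_lat a r t)).
    { intros t x y; pose proof (kerr_lat_ge_1 a r t).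
      pose proof (pow2_ge_0 x); pose proof (pow2_ge_0 y); nra. }
    eapply lipschitz_pair_ext;
      [apply (lipschitz_pair_sqrt d
         (fun t => kerr_lat a r t * (x1 t ^ 2 + y1 t ^ 2 + kerr_lat a r t))
         (fun t => kerr_lat a r t * (x2 t ^ 2 + y2 t ^ 2 + kerr_lat a r t))) | ].
    - intros t _; apply hge.
    - intros t _; apply hge.
    - apply lipschitz_pair_mult; [exact hlat | ].
      apply lipschitz_pair_plus; [ | exact hlat].
      apply lipschitz_pair_plus; apply sq; assumption.
    - intros t _; unfold alpha_t, kerr_lat.
      split; do 2 f_equal; ring. }
  assert (hiell : lipschitz_pair d (fun t => / ell_t a r t (y1 t))
                    (fun t => / ell_t a r t (y2 t))).
  { apply lipschitz_pair_inv; [intros; apply hell | intros; apply hell | ].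
    eapply lipschitz_pair_ext;
      [exact (lipschitz_pair_plus _ _ _ _ _ (sq _ _ hy) hlat) | ].
    intros t _; unfold ell_t, kerr_lat; lra. }
  assert (hys : lipschitz_pair d (fun t => y1 t * beta_sigma m a r t (y1 t))
                  (fun t => y2 t * beta_sigma m a r t (y2 t))).
  { apply (lipschitz_pair_mult_weighted d sin); auto using bounded_beta_sigma.
    eapply lipschitz_pair_ext; [apply (lipschitz_pair_beta m a r d y1 y2); auto | ].
    intros t ht; pose proof (hsin t ht); unfold beta_sigma; split; field; lra. }
  assert (hyu : lipschitz_pair d (fun t => y1 t * (y1 t / sin t))
                  (fun t => y2 t * (y2 t / sin t))).
  { apply (lipschitz_pair_mult_weighted d sin); auto.
    apply (lipschitz_pair_ext _ _ _ _ _ hy).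
    intros t ht; pose proof (hsin t ht); split; field; lra. }
  eapply lipschitz_pair_ext;
    [ | intros t ht; split; apply (rhs_x_eq m a r t); assumption].
  apply lipschitz_pair_minus; [apply lipschitz_pair_minus | ].
  - apply lipschitz_pair_mult; [ | exact hy].
    apply lipschitz_pair_refl, bounded_mult; [apply bounded_const | ].
    apply bounded_kerr_P; assumption.
  - apply lipschitz_pair_mult; [ | exact hx].
    apply lipschitz_pair_refl, bounded_kerr_B.
  - apply lipschitz_pair_mult; [apply lipschitz_pair_plus | ].
    + apply lipschitz_pair_mult; assumption.
    + apply lipschitz_pair_mult; [apply lipschitz_pair_mult; assumption | ].
      apply lipschitz_pair_refl, bounded_div;
        [apply bounded_kerr_eta; lra | intros; lra].
    + apply lipschitz_pair_mult; [ | exact hiell].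
      apply lipschitz_pair_refl, bounded_inv; intros t _.
      apply kerr_h_ge_1; assumption.
Qed.

(** * Uniqueness *)

(* Solutions are extended past the poles by constants, so that continuity on
   [0, PI] becomes continuity on the line. *)
Lemma solution_extension (m a r : R) (x y : R -> R) :
  0 <= a -> a <= m -> 2 * m < r ->
  is_solution m a r x y -> bounded_derivatives x y ->
  exists u v,
    (forall t, 0 <= t <= PI -> u t = x t /\ v t = y t) /\
    continuity u /\ continuity v /\
    (forall t, 0 < t < PI ->
       is_derive v t (rhs_y m a r t (u t) (v t)) /\
       is_derive u t (rhs_x m a r t (u t) (v t))) /\
    bounded u /\ bounded v /\ bounded (fun t => v t / sin t).
Proof.
  intros ha ham hr [cx [cy hd]] [M hM].
  assert (hpi : 0 <= PI) by (pose proof PI_RGT_0; lra).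
  set (u := fun t => x (clamp 0 PI t)); set (v := fun t => y (clamp 0 PI t)).
  assert (hu : forall t, 0 <= t <= PI -> u t = x t)
    by (intros t ht; unfold u; rewrite clamp_id; auto).
  assert (hv : forall t, 0 <= t <= PI -> v t = y t)
    by (intros t ht; unfold v; rewrite clamp_id; auto).
  assert (cu : continuity u) by (apply continuous_on_clamp; assumption).
  assert (cv : continuity v) by (apply continuous_on_clamp; assumption).
  assert (hb : forall f, continuity f -> bounded f).
  { intros f cf.
    destruct (continuity_ab_maj (fun t => Rabs (f t)) 0 PI hpi) as [t0 [h _]].
    - intros t _; apply (continuity_pt_comp f Rabs); [apply cf | ].
      apply Rcontinuity_abs.
    - exists (Rabs (f t0)); intros t ht; apply h; lra. }
  assert (hdv : forall t, 0 < t < PI ->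
    is_derive v t (rhs_y m a r t (u t) (v t)) /\
    is_derive u t (rhs_x m a r t (u t) (v t))).
  { intros t ht; rewrite hu, hv by lra.
    split; apply is_derive_clamp; try exact ht; apply hd, ht. }
  exists u, v; do 6 (split; [auto | ]).
  apply (bounded_div_sin m a r u v); auto.
  (* The bound on the derivative of [y] is a bound on [rhs_y] along the solution. *)
  exists M; intros t ht; rewrite hu, hv by lra.
  rewrite <- (is_derive_unique _ _ _ (proj1 (hd t ht))); apply hM, ht.
Qed.

(** The inequality [v ^ 2 <= M ^ 2 * sin ^ 2] extends by continuity to the poles, where [sin] is
    0. *)
Lemma vanishes_at_poles (v : R -> R) :
  continuity v -> bounded (fun t => v t / sin t) -> v 0 = 0 /\ v PI = 0.
Proof.
  intros cv [M hM]; pose proof PI_RGT_0 as hpi.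
  assert (h : forall t, 0 <= t <= PI -> v t ^ 2 - M ^ 2 * sin t ^ 2 <= 0).
  { apply nonpos_closure; [exact hpi | | ].
    - intros t; apply continuity_pt_minus; simpl.
      + repeat apply continuity_pt_mult; try apply cv.
        apply continuity_pt_const; intros ? ?; reflexivity.
      + apply derivable_continuous_pt; reg.
    - intros t ht; pose proof (hM t ht) as h.
      assert (0 < sin t) by (apply sin_gt_0; lra).
      replace (v t) with (v t / sin t * sin t) by (field; lra).
      rewrite Rpow_mult_distr, <- (pow2_abs (v t / sin t)).
      pose proof (pow_incr _ _ 2 (conj (Rabs_pos _) h)).
      pose proof (pow2_ge_0 (sin t)); nra. }
  pose proof (h 0 ltac:(lra)) as h0; pose proof (h PI ltac:(lra)) as h1.
  rewrite sin_0 in h0; rewrite sin_PI in h1.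
  pose proof (pow2_ge_0 (v 0)); pose proof (pow2_ge_0 (v PI)).
  split; apply Rsqr_eq_0; rewrite Rsqr_pow2; lra.
Qed.

Theorem theorem4p1 (m a r : R) (ha0 : 0 <= a) (ham : a <= m) (hr : 2 * m < r)
    (x1 y1 x2 y2 : R -> R)
    (hsol1 : is_solution m a r x1 y1) (hbd1 : bounded_derivatives x1 y1)
    (hsol2 : is_solution m a r x2 y2) (hbd2 : bounded_derivatives x2 y2) :
  (y1 0 = 0 /\ y1 PI = 0 /\ y2 0 = 0 /\ y2 PI = 0) /\
  (x1 0 = x2 0 \/ x1 PI = x2 PI ->
   forall t : R, 0 <= t <= PI -> x1 t = x2 t /\ y1 t = y2 t).
Proof.
  pose proof PI_RGT_0 as hpi.
  destruct (solution_extension m a r x1 y1 ha0 ham hr hsol1 hbd1)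
    as [u1 [v1 [e1 [cu1 [cv1 [d1 [bu1 [bv1 bs1]]]]]]]].
  destruct (solution_extension m a r x2 y2 ha0 ham hr hsol2 hbd2)
    as [u2 [v2 [e2 [cu2 [cv2 [d2 [bu2 [bv2 bs2]]]]]]]].
  destruct (vanishes_at_poles v1 cv1 bs1) as [z10 z1p].
  destruct (vanishes_at_poles v2 cv2 bs2) as [z20 z2p].
  destruct (e1 0 ltac:(lra)) as [ex10 ey10].
  destruct (e1 PI ltac:(lra)) as [ex1p ey1p].
  destruct (e2 0 ltac:(lra)) as [ex20 ey20].
  destruct (e2 PI ltac:(lra)) as [ex2p ey2p].
  split; [repeat split; congruence | intros hini].
  set (d := fun t => Rabs (u1 t - u2 t) + Rabs (v1 t - v2 t)).
  assert (hd : forall f g, bounded f -> bounded g ->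
    (forall t, Rabs (f t - g t) <= d t) -> lipschitz_pair d f g).
  { intros f g hf hg h; repeat split; auto; exists 1; intros t _.
    rewrite Rmult_1_l; apply h. }
  assert (hu : lipschitz_pair d u1 u2).
  { apply hd; auto; intros t; unfold d.
    pose proof (Rabs_pos (v1 t - v2 t)); lra. }
  assert (hv : lipschitz_pair d v1 v2).
  { apply hd; auto; intros t; unfold d.
    pose proof (Rabs_pos (u1 t - u2 t)); lra. }
  destruct (lipschitz_pair_rhs_x m a r d u1 v1 u2 v2) as [_ [_ [K1 hK1]]]; auto.
  (* The right-hand side of the [y] equation without its singular term [- w * y]. *)
  set (reg_y := fun t x y =>
    - (sqrt (Delta_t m a r) * kerr_P m a r t * x) - kerr_B a r t * y).
  assert (hreg : lipschitz_pair d (fun t => reg_y t (u1 t) (v1 t))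
                   (fun t => reg_y t (u2 t) (v2 t))).
  { apply lipschitz_pair_minus.
    - apply lipschitz_pair_opp, lipschitz_pair_mult; [ | exact hu].
      apply lipschitz_pair_refl, bounded_mult; [apply bounded_const | ].
      apply bounded_kerr_P; assumption.
    - apply lipschitz_pair_mult; [ | exact hv].
      apply lipschitz_pair_refl, bounded_kerr_B. }
  destruct hreg as [_ [_ [K2 hK2]]].
  assert (hws : bounded (fun t => kerr_w m a r t * sin t)).
  { apply (bounded_ext _ (fun t => cos t * (1 + kerr_k m a r t))).
    - apply bounded_mult; [apply bounded_cos | ].
      apply bounded_plus; [apply bounded_const | apply bounded_kerr_k; assumption].
    - intros t ht; pose proof (sin_gt_0 t); unfold kerr_w; field; lra. }
  destruct hws as [W hW].
  assert (hd0 : forall t, 0 <= d t).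
  { intros t; unfold d; pose proof (Rabs_pos (u1 t - u2 t)).
    pose proof (Rabs_pos (v1 t - v2 t)); lra. }
  assert (hzero : forall t, 0 <= t <= PI -> u1 t - u2 t = 0 /\ v1 t - v2 t = 0).
  { apply (singular_linear_uniqueness (fun t => u1 t - u2 t)
      (fun t => v1 t - v2 t)
      (fun t => rhs_x m a r t (u1 t) (v1 t) - rhs_x m a r t (u2 t) (v2 t))
      (fun t => reg_y t (u1 t) (v1 t) - reg_y t (u2 t) (v2 t))
      (kerr_w m a r) (Rmax K1 K2) W).
    - intros t; apply continuity_pt_minus; auto.
    - intros t; apply continuity_pt_minus; auto.
    - intros t ht; apply (is_derive_minus (V := R_NormedModule));
        [apply d1, ht | apply d2, ht].
    - intros t ht.
      replace (reg_y t (u1 t) (v1 t) - reg_y t (u2 t) (v2 t)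
               - kerr_w m a r t * (v1 t - v2 t))
        with (rhs_y m a r t (u1 t) (v1 t) - rhs_y m a r t (u2 t) (v2 t))
        by (rewrite !rhs_y_eq; unfold reg_y; ring).
      apply (is_derive_minus (V := R_NormedModule));
        [apply d1, ht | apply d2, ht].
    - intros t ht; apply Rle_trans with (1 := hK1 t ht).
      apply Rmult_le_compat_r; [apply hd0 | apply Rmax_l].
    - intros t ht; apply Rle_trans with (1 := hK2 t ht).
      apply Rmult_le_compat_r; [apply hd0 | apply Rmax_r].
    - intros t ht; pose proof (kerr_k_nonneg m a r t ha0 ham hr).
      assert (hs : 0 < sin t) by (apply sin_gt_0; lra).
      replace (kerr_w m a r t * cos t)
        with (cos t ^ 2 / sin t * (1 + kerr_k m a r t))
        by (unfold kerr_w; field; lra).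
      apply Rmult_le_pos; [ | lra].
      apply Rdiv_le_0_compat; [apply pow2_ge_0 | exact hs].
    - intros t ht; assert (hs : 0 < sin t) by (apply sin_gt_0; lra).
      rewrite <- (Rabs_pos_eq (sin t)) by lra.
      rewrite <- Rabs_mult; apply hW, ht.
    (* The [y] components both vanish at the poles, so equality of the [x] components at one pole is
       full initial data there. *)
    - destruct hini as [h | h]; [left | right]; lra. }
  intros t ht; destruct (hzero t ht), (e1 t ht), (e2 t ht); lra.
Qed.
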